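(* Let $L:\mathbb{R}^+\to\mathbb{R}^+$ be a measurable function such that $L(x)\to 0$ as $x\to\infty$ and $\int_a^\infty L(t)t^{-1}\,dt=\infty$. Let $\rho\in\mathbb{R}$. If $U\in\mathcal{M}_0(L,\rho)$, then $U\in\mathcal{M}(0)$.
   Context: $\mathbb{R}^+=(0,\infty)$; $a\ge 0$ is a fixed real number and $\int_a^x L(t)t^{-1}\,dt<\infty$ for every finite $x>a$. For $L$ as in the claim, $\mathcal{M}_0(L,\rho)$ is the class of positive measurable functions $U$ on $\mathbb{R}^+$, bounded on finite intervals, such that $\lim_{x\to\infty}\frac{\log U(x)}{\int_a^x L(t)t^{-1}\,dt}=\rho$. $\mathcal{M}(0)$ is the class of positive measurable functions $U$ on $\mathbb{R}^+$, bounded on finite intervals, such that $\lim_{x\to\infty}\frac{\log U(x)}{\log x}=0$. *)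

(* Defs.v *)
From HB Require Import structures.
From mathcomp Require Import all_boot all_order all_algebra.
From mathcomp Require Import all_classical all_reals all_analysis.
Set Implicit Arguments.
Unset Strict Implicit.
Unset Printing Implicit Defensive.
Import Order.TTheory GRing.Theory Num.Theory.
Import numFieldNormedType.Exports.
Local Open Scope classical_set_scope.
Local Open Scope ring_scope.

(* Functions on R^+ = ]0, +oo[ are total functions R -> R of which only the
   restriction to [posR] matters. *)
Definition posR (R : realType) : set R := `]0, +oo[.
Arguments posR {R}.

(* "Finite interval" means any bounded interval included in R^+, which allows
   0 as an endpoint: such functions are bounded near 0. *)
Definition bounded_on_finite_intervals (R : realType) (U : R -> R) : Prop :=
  forall I : set R, is_interval I -> bounded_set I -> I `<=` posR ->
    [bounded U x | x in I].

Definition positive_measurable_locally_bounded (R : realType) (U : R -> R)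
    : Prop :=
  [/\ forall x, posR x -> 0 < U x,
      measurable_fun posR U &
      bounded_on_finite_intervals U].

(* The interval is open at a because a = 0 is allowed, and 0 is outside R^+. *)
Definition int_L (R : realType) (a : R) (L : R -> R) (x : R) : \bar R :=
  (\int[lebesgue_measure]_(t in `]a, x]) (L t * t^-1)%:E)%E.

(* The integral is finite for all x > a under the standing assumption on L,
   so that [fine] only casts it to R. *)
Definition class_M0 (R : realType) (a : R) (L : R -> R) (rho : R) (U : R -> R)
    : Prop :=
  positive_measurable_locally_bounded U /\
  ln (U x) / fine (int_L a L x) @[x --> +oo] --> rho.

Definition class_M_zero (R : realType) (U : R -> R) : Prop :=
  positive_measurable_locally_bounded U /\
  ln (U x) / ln x @[x --> +oo] --> 0.

(* Main.v *)
Require Import Defs.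
From HB Require Import structures.
From mathcomp Require Import all_boot all_order all_algebra.
From mathcomp Require Import all_classical all_reals all_analysis.
From mathcomp Require Import measurable_realfun.
Set Implicit Arguments.
Unset Strict Implicit.
Unset Printing Implicit Defensive.
Import Order.TTheory GRing.Theory Num.Theory.
Import numFieldNormedType.Exports.
Local Open Scope classical_set_scope.
Local Open Scope ring_scope.

(** Write [I x] for the integral of [L t / t] over the interval from [a] to
    [x]. Since [L] tends to [0], the integrand is, for every [e > 0],
    eventually at most [e / t], whose integral grows like [e * ln x];
    hence [I x / ln x] tends to [0] ([cvg_int_L_div_ln]). For [x > a] the number [I x] is nonzero, because a positive function has a
    positive integral on a set of positive measure ([integral_gt0]), so that
    [ln (U x) / ln x = (ln (U x) / I x) * (I x / ln x)], and the right-hand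
    side tends to [rho * 0 = 0]. *)

(** A nonnegative function with a null integral vanishes almost everywhere, so
    a positive one would force its domain to be negligible. *)
Lemma integral_gt0 d (T : measurableType d) (R : realType)
    (mu : {measure set T -> \bar R}) (D : set T) (f : T -> \bar R) :
  measurable D -> (0 < mu D)%E -> measurable_fun D f ->
  (forall x, D x -> (0 < f x)%E) -> (0 < \int[mu]_(x in D) f x)%E.
Proof.
move=> mD muD mf f0; rewrite lt0e integral_ge0 ?andbT//; last first.
  by move=> x /f0/ltW.
apply/eqP => intf0; move: muD; suff -> : mu D = 0%E by rewrite ltxx.
apply/negligibleP => //.
have [|N [mN muN0 ND]] := (ae_eq_integral_abs mu mD mf).1.
  rewrite -[RHS]intf0; apply: eq_integral => x /set_mem Dx.
  by rewrite gee0_abs// ltW// f0.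
exists N; split => // x Dx; apply: ND => /= /(_ Dx) fx0.
by have := f0 _ Dx; rewrite fx0 ltxx.
Qed.

Lemma cvg_ln_pinfty (R : realType) : @ln R x @[x --> +oo] --> +oo.
Proof.
apply/cvgryPge => A; near=> x.
have x_ge : expR A <= x by near: x; exact: nbhs_pinfty_ge.
by rewrite -ler_expR lnK// posrE (lt_le_trans _ x_ge)// expR_gt0.
Unshelve. all: by end_near. Qed.

Lemma measurable_inv_posR (R : realType) :
  measurable_fun (@posR R) (fun t : R => t^-1).
Proof.
apply: open_continuous_measurable_fun; first exact: interval_open.
move=> t; rewrite inE /posR/= in_itv/= andbT => t0.
by apply: inv_continuous; rewrite gt_eqF.
Qed.

Lemma integral_inv_ln (R : realType) (x y : R) : 0 < x -> x < y ->
  (\int[lebesgue_measure]_(t in `]x, y]) (t^-1)%:E = (ln y - ln x)%:E)%E.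
Proof.
move=> x0 xy; have y0 := lt_trans x0 xy.
have cV : {within `[x, y], continuous (fun t : R => t^-1)}.
  apply: continuous_in_subspaceT => t; rewrite inE/= in_itv/= => /andP[xt _].
  by apply: inv_continuous; rewrite gt_eqF// (lt_le_trans x0).
rewrite integral_itv_obnd_cbnd; last first.
  apply/measurable_EFinP; apply: measurable_funS (@measurable_inv_posR R).
    exact: measurable_itv.
  move=> t /=; rewrite /posR/= !in_itv/= andbT => /andP[xt _].
  exact: lt_trans xt.
rewrite (continuous_FTC2 xy cV (F := @ln R))//.
- split.
  + move=> t; rewrite in_itv/= => /andP[xt _].
    by have [] := is_derive1_ln (lt_trans x0 xt).
  + by apply: cvg_at_right_filter; exact: continuous_ln.
  + by apply: cvg_at_left_filter; exact: continuous_ln.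
- move=> t; rewrite in_itv/= => /andP[xt _]; rewrite derive1E.
  by have [_] := is_derive1_ln (lt_trans x0 xt).
Qed.

Section int_L_theory.
Context (R : realType) (a : R) (L : R -> R).
Hypothesis a_ge0 : 0 <= a.
Hypothesis L_pos : forall x, posR x -> 0 < L x.
Hypothesis L_meas : measurable_fun posR L.
Hypothesis L_fin : forall x, a < x -> (int_L a L x < +oo)%E.

Let g (t : R) : \bar R := (L t * t^-1)%:E.

Let posR_itv (c x t : R) : 0 <= c -> `]c, x]%classic t -> posR t.
Proof.
move=> c0; rewrite /posR/= !in_itv/= andbT => /andP[ct _].
exact: le_lt_trans ct.
Qed.

Let measurable_g (c x : R) : 0 <= c -> measurable_fun `]c, x] g.
Proof.
move=> c0; apply/measurable_EFinP.
apply: (@measurable_funS _ _ _ _ posR) => //; first exact: measurable_itv.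
  by move=> t; exact: posR_itv.
by apply: measurable_funM => //; exact: measurable_inv_posR.
Qed.

Let g_gt0 (c x t : R) : 0 <= c -> `]c, x]%classic t -> (0 < g t)%E.
Proof.
move=> c0 /(posR_itv c0) pt; rewrite lte_fin mulr_gt0 ?L_pos//.
by move: pt; rewrite /posR/= in_itv/= andbT invr_gt0.
Qed.

Lemma int_L_ge0 (x : R) : (0 <= int_L a L x)%E.
Proof. by apply: integral_ge0 => t /(g_gt0 a_ge0)/ltW. Qed.

Lemma fineK_int_L (x : R) : a < x -> (fine (int_L a L x))%:E = int_L a L x.
Proof. by move=> ax; rewrite fineK// ge0_fin_numE ?L_fin// int_L_ge0. Qed.

Lemma fine_int_L_gt0 (x : R) : a < x -> 0 < fine (int_L a L x).
Proof.
move=> ax; rewrite -lte_fin fineK_int_L//.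
apply: integral_gt0 => //; last 2 first.
- exact: measurable_g.
- by move=> t; exact: g_gt0.
by rewrite /= lebesgue_measure_itv/= lte_fin ax lte_fin subr_gt0.
Qed.

(** Past [b] the integrand is at most [e / t], a primitive of which is
    [e * ln t]: this is where a bound on [L] becomes a logarithmic bound. *)
Lemma fine_int_L_le (e b x : R) : a < b -> b < x -> 0 <= e ->
  (forall t, b < t -> L t <= e) ->
  fine (int_L a L x) <= fine (int_L a L b) + e * (ln x - ln b).
Proof.
move=> ab bx e0 Le; have b0 := le_lt_trans a_ge0 ab.
rewrite -lee_fin EFinD !fineK_int_L ?(lt_trans ab bx)//.
have minv : measurable_fun `]b, x] (fun t : R => (t^-1)%:E).
  apply/measurable_EFinP; apply: measurable_funS (@measurable_inv_posR R).
    exact: measurable_itv.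
  by move=> t; apply: posR_itv; exact: ltW.
have abx : `]a, x]%classic = `]a, b] `|` `]b, x].
  by apply: itv_bndbnd_setU; rewrite bnd_simp ltW.
rewrite {1}/int_L abx ge0_integral_setU//; last 3 first.
- by rewrite -abx; exact: measurable_g.
- by rewrite -abx => t /(g_gt0 a_ge0)/ltW.
- rewrite disj_set2E; apply/eqP/seteqP; split => // t [] /=.
  by rewrite !in_itv/= => /andP[_ tb] /andP[bt _]; move: tb; rewrite leNgt bt.
apply: leeD => //.
rewrite EFinM -integral_inv_ln// -ge0_integralZl//.
- apply: ge0_le_integral => //.
  + by move=> t /(g_gt0 (ltW b0))/ltW.
  + by apply: measurable_g; exact: ltW.
  + exact: measurable_funeM.
  + move=> t /=; rewrite in_itv/= => /andP[bt _].
    by rewrite -EFinM lee_fin ler_wpM2r ?Le// invr_ge0 ltW// (lt_trans b0).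
- move=> t /=; rewrite in_itv/= => /andP[bt _].
  by rewrite lee_fin invr_ge0 ltW// (lt_trans b0).
Qed.

Hypothesis L_cvg0 : L x @[x --> +oo] --> 0.

(** Bounding [L] by [e / 2] leaves the other [e / 2 * ln x] to absorb the
    integral up to the point [b] past which that bound holds. *)
Lemma cvg_int_L_div_ln : fine (int_L a L x) / ln x @[x --> +oo] --> 0.
Proof.
apply/cvgr0Pnorm_le => e e0; have e20 : 0 < e / 2 by rewrite divr_gt0.
have [M [_ LM]] := (cvgr0Pnorm_le _).1 L_cvg0 _ e20.
(* [1 <= b] makes the term [- e / 2 * ln b] nonpositive. *)
have [b [ab b1 Lb]] :
    exists b, [/\ a < b, 1 <= b & forall t, b < t -> L t <= e / 2].
  exists (Num.max (a + 1) (Num.max M 1)); split.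
  - by rewrite lt_max ltrDl ltr01.
  - by rewrite !le_max lexx !orbT.
  - move=> t; rewrite !gt_max => /and3P[_ Mt _].
    by rewrite (le_trans (ler_norm _))// LM.
near=> x.
have bx : b < x by near: x; apply: nbhs_pinfty_gt; exact: num_real.
have lnx0 : 0 < ln x by rewrite ln_gt0// (le_lt_trans b1).
have lnx : fine (int_L a L b) / (e / 2) <= ln x.
  by near: x; apply: (cvgryPge _).1; exact: cvg_ln_pinfty.
rewrite ger0_norm; last first.
  by rewrite divr_ge0 ?(ltW lnx0)// fine_ge0// int_L_ge0.
rewrite ler_pdivrMr//; apply: (le_trans (fine_int_L_le ab bx (ltW e20) Lb)).
rewrite {2}(splitr e) mulrDl lerD//; first by rewrite mulrC -ler_pdivrMr.
by rewrite ler_wpM2l ?(ltW e20)// gerBl ln_ge0.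
Unshelve. all: by end_near. Qed.

End int_L_theory.

Theorem proposition2p3 (R : realType) (a : R) (ha : 0 <= a) (L : R -> R)
  (L_pos : forall x, posR x -> 0 < L x)
  (L_meas : measurable_fun posR L)
  (L_fin : forall x, a < x -> (int_L a L x < +oo)%E)
  (L_cvg0 : L x @[x --> +oo] --> 0)
  (L_int : (\int[lebesgue_measure]_(t in `]a, +oo[) (L t * t^-1)%:E)%E = +oo%E)
  (rho : R) (U : R -> R) (hU : class_M0 a L rho U) :
  class_M_zero U.
Proof.
have [U_reg U_cvg] := hU; split => //.
rewrite -(mulr0 rho).
have UI : (ln (U x) / fine (int_L a L x)) * (fine (int_L a L x) / ln x)
    @[x --> +oo] --> rho * 0.
  by apply: cvgM U_cvg _; exact: cvg_int_L_div_ln.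
apply: cvg_trans UI; apply: near_eq_cvg; near=> x.
have ax : a < x by near: x; apply: nbhs_pinfty_gt; exact: num_real.
by rewrite /= mulrA divfK// gt_eqF// fine_int_L_gt0.
Unshelve. all: by end_near. Qed.
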